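(* Let $b(\cdot;\theta):[0,1]\to\mathbb{R}^2$ be a cubic Bézier curve with control points $\theta$ and locus $\mathcal{B}(\theta)=b([0,1];\theta)$. Let $S\ge 1$ be an integer and let $\mathcal{P}_S(\theta)$ be the $S$-segment polyline with vertices $b(k/S;\theta)$, $k=0,\dots,S$. Put $$M(\theta)=\max_{t\in[0,1]}\|b''(t;\theta)\|_2,\qquad \varepsilon_S(\theta)=\frac{M(\theta)}{8S^2}.$$ Then: (a) $\operatorname{H}\bigl(\mathcal{B}(\theta),\mathcal{P}_S(\theta)\bigr)\le\varepsilon_S(\theta)$, where $\operatorname{H}$ is the Hausdorff distance. (b) For every $x\in\mathbb{R}^2$, $\bigl|d_{\mathcal{B}}(x;\theta)-\tilde d(x;\theta)\bigr|\le \operatorname{H}\bigl(\mathcal{B}(\theta),\mathcal{P}_S(\theta)\bigr)\le\varepsilon_S(\theta)$. (c) (Stroke mode.) If the coverage kernel $K:\mathbb{R}\to[0,1]$ is $L_K$-Lipschitz, then the stroke coverages satisfy $|\alpha(x;\theta)-\tilde\alpha(x;\theta)|\le L_K\,\varepsilon_S(\theta)$ for every $x\in\mathbb{R}^2$. (d) (Fill mode.) Suppose the curve is closed, $b(0;\theta)=b(1;\theta)$, and $K:\mathbb{R}\to[0,1]$ is $L_K$-Lipschitz. Then the fill coverages satisfy $|\alpha(x;\theta)-\tilde\alpha(x;\theta)|\le L_K\,\varepsilon_S(\theta)$ at every $x$ at which $\mathcal{B}(\theta)$ and $\mathcal{P}_S(\theta)$ have the same inside/outside label. A sufficient condition for equality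 of the labels at $x$ is $d_{\mathcal{B}}(x;\theta)>\varepsilon_S(\theta)$. Where the labels differ, the bound holds with an additional term of magnitude at most $1$, namely $$|\alpha(x;\theta)-\tilde\alpha(x;\theta)|\le L_K\,\varepsilon_S(\theta)+\bigl|\mathbf 1_{\mathrm{inside}}(x;\theta)-\tilde{\mathbf 1}_{\mathrm{inside}}(x;\theta)\bigr|.$$
   Context: A cubic Bézier curve with control points $P_0,\dots,P_3\in\mathbb{R}^2$ is $b(t)=\sum_{j=0}^3\binom{3}{j}(1-t)^{3-j}t^jP_j$, $t\in[0,1]$; primes denote derivatives in $t$. The polyline $\mathcal{P}_S(\theta)$ is the union of the line segments joining consecutive vertices $b(k/S;\theta)$ and $b((k+1)/S;\theta)$, $k=0,\dots,S-1$. Distances: $d_{\mathcal{B}}(x;\theta)=\inf_{y\in\mathcal{B}(\theta)}\|x-y\|_2$ and $\tilde d(x;\theta)=\inf_{y\in\mathcal{P}_S(\theta)}\|x-y\|_2$. Labels (closed curves): $\mathbf 1_{\mathrm{inside}}(x;\theta)\in\{0,1\}$ equals $1$ iff the winding number about $x$ of the closed curve $b$ is nonzero (nonzero winding rule, for $x$ off the curve; on the curve any fixed convention is used); $\tilde{\mathbf 1}_{\mathrm{inside}}(x;\theta)$ is the same for the closed polyline $\mathcal{P}_S(\theta)$. The corresponding signs are $s(x)=+1$ if inside and $-1$ otherwise, and similarly $\tilde s(x)$. Coverages: the coverage is the kernel $K$ applied to a signed residual. In stroke mode, with half-width $r\ge 0$, $\alpha(x;\theta)=K(r-d_{\mathcal{B}}(x;\theta))$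 and $\tilde\alpha(x;\theta)=K(r-\tilde d(x;\theta))$. In fill mode, $\alpha(x;\theta)=K(s(x)\,d_{\mathcal{B}}(x;\theta))$ and $\tilde\alpha(x;\theta)=K(\tilde s(x)\,\tilde d(x;\theta))$. (The softness scale of the kernel is absorbed into $K$.) *)

(* Defs.v *)
From HB Require Import structures.
From mathcomp Require Import all_boot all_order all_algebra.
From mathcomp Require Import all_classical all_reals all_analysis.

Set Implicit Arguments.
Unset Strict Implicit.
Unset Printing Implicit Defensive.

Import Order.TTheory GRing.Theory Num.Theory.
Import numFieldNormedType.Exports.

Local Open Scope classical_set_scope.
Local Open Scope ring_scope.

(* The library norm `|v| on row vectors is the sup norm; all distances below
   use this Euclidean norm instead.  (Both induce the same topology, hence the
   same derivatives.) *)
Definition norm2 (R : realType) (n : nat) (v : 'rV[R]_n) : R :=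
  Num.sqrt (\sum_(i < n) v ord0 i ^+ 2).

(* [inf] and [sup] are real-valued and return 0 on unbounded or empty sets:
   [dist_to x A] is meaningful for A nonempty, [hausdorff_dist A B] for A and B
   nonempty and bounded.  Curves and polylines below are such sets. *)
Definition dist_to (R : realType) (n : nat) (x : 'rV[R]_n) (A : set 'rV[R]_n)
  : R := inf [set norm2 (x - y) | y in A].

Definition hausdorff_dist (R : realType) (n : nat) (A B : set 'rV[R]_n) : R :=
  Num.max (sup [set dist_to a B | a in A]) (sup [set dist_to b A | b in B]).

Definition bezier (R : realType) (theta : 'I_4 -> 'rV[R]_2) (t : R)
  : 'rV[R]_2 :=
  \sum_(j < 4) (('C(3, j))%:R * (1 - t) ^+ (3 - j) * t ^+ j) *: theta j.

Definition locus (R : realType) (gamma : R -> 'rV[R]_2) : set 'rV[R]_2 :=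
  gamma @` `[0, 1].

Definition segment (R : realType) (P Q : 'rV[R]_2) : set 'rV[R]_2 :=
  [set (1 - u) *: P + u *: Q | u in `[0, 1]].

Definition polyline_vertex (R : realType) (theta : 'I_4 -> 'rV[R]_2) (S k : nat)
  : 'rV[R]_2 := bezier theta (k%:R / S%:R).

Definition polyline (R : realType) (theta : 'I_4 -> 'rV[R]_2) (S : nat)
  : set 'rV[R]_2 :=
  \bigcup_(k in [set k | (k < S)%N])
    segment (polyline_vertex theta S k) (polyline_vertex theta S k.+1).

(* The polyline traversed over [0, 1], affinely from vertex k to vertex k + 1
   on [k/S, (k+1)/S].  At t = 1 the index k is S, but the point S + 1 then has
   weight 0. *)
Definition polyline_path (R : realType) (theta : 'I_4 -> 'rV[R]_2) (S : nat)
    (t : R) : 'rV[R]_2 :=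
  let k := Num.truncn (S%:R * t) in
  let u := S%:R * t - k%:R in
  (1 - u) *: polyline_vertex theta S k + u *: polyline_vertex theta S k.+1.

(* M(theta) is a maximum: it is attained, see [bezier_d2_max_attained]. *)
Definition bezier_d2_max (R : realType) (theta : 'I_4 -> 'rV[R]_2) : R :=
  sup [set norm2 ((bezier theta)^`(2)%classic t) | t in `[0, 1]].

Definition flattening_error (R : realType) (theta : 'I_4 -> 'rV[R]_2) (S : nat)
  : R := bezier_d2_max theta / (8 * S%:R ^+ 2).

(* [phi] is a continuous determination of the angle of [gamma t - x]. *)
Definition angle_lift (R : realType) (gamma : R -> 'rV[R]_2) (x : 'rV[R]_2)
    (phi : R -> R) : Prop :=
  {within `[0, 1], continuous phi} /\
  forall t, t \in `[0, 1] ->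
    gamma t - x = norm2 (gamma t - x) *:
      \row_(i < 2) (if i == ord0 then cos (phi t) else sin (phi t)).

(* The number of turns made by the angle: for [gamma] a continuous closed curve
   avoiding [x] such an n exists and is unique, so the default 0 of [xget] is
   irrelevant. *)
Definition winding_number (R : realType) (gamma : R -> 'rV[R]_2)
    (x : 'rV[R]_2) : int :=
  xget 0 [set n : int | exists phi : R -> R,
    angle_lift gamma x phi /\ phi 1 - phi 0 = n%:~R * (2 * pi)].

(* Nonzero winding rule off the curve; [oncurve] is the convention used on the
   curve. *)
Definition inside (R : realType)
    (oncurve : (R -> 'rV[R]_2) -> 'rV[R]_2 -> bool)
    (gamma : R -> 'rV[R]_2) (x : 'rV[R]_2) : bool :=
  if x \in locus gamma then oncurve gamma x else winding_number gamma x != 0.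

Definition stroke_coverage (R : realType) (K : R -> R) (r : R)
    (A : set 'rV[R]_2) (x : 'rV[R]_2) : R :=
  K (r - dist_to x A).

Definition label_sign (R : realType) (label : bool) : R :=
  if label then 1 else -1.

Definition fill_coverage (R : realType) (K : R -> R) (label : bool)
    (A : set 'rV[R]_2) (x : 'rV[R]_2) : R :=
  K (label_sign R label * dist_to x A).

Lemma bezier_d2E (R : realType) (theta : 'I_4 -> 'rV[R]_2) :
  exists q : 'I_2 -> {poly R},
    (bezier theta)^`(2)%classic = fun t => \row_i (q i).[t].
Proof.
have D (q : 'I_2 -> {poly R}) :
    (fun t => \row_i (q i).[t] : 'rV[R]_2)^`()%classic
    = fun t => \row_i ((q i)^`()%R).[t].
  apply/funext => t; rewrite derive1E derive_mx; last first.
    apply/derivable_mxP => i j.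
    rewrite (_ : (fun _ => _) = horner (q j)); first exact: derivable_horner.
    by apply/funext => u; rewrite mxE.
  apply/rowP => i; rewrite !mxE.
  rewrite (_ : (fun _ => _) = horner (q i)); last first.
    by apply/funext => u; rewrite mxE.
  by rewrite derivE derive1E.
pose q i := \sum_(j < 4) theta j ord0 i *:
  (('C(3, j))%:R *: ((1 - 'X) ^+ (3 - j) * 'X ^+ j)) : {poly R}.
exists (fun i => (q i)^`()^`())%R.
have -> : bezier theta = fun t => \row_i (q i).[t].
  apply/funext => t; apply/rowP => i; rewrite !mxE summxE horner_sum.
  apply: eq_bigr => j _; rewrite !mxE !hornerE.
  by rewrite [LHS]mulrC !mulrA.
by rewrite /derive1n /= !D.
Qed.

Lemma bezier_d2_max_attained (R : realType) (theta : 'I_4 -> 'rV[R]_2) :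
  (exists2 t, t \in `[0, 1] &
     norm2 ((bezier theta)^`(2)%classic t) = bezier_d2_max theta) /\
  (forall t, t \in `[0, 1] ->
     norm2 ((bezier theta)^`(2)%classic t) <= bezier_d2_max theta).
Proof.
have [q qE] := bezier_d2E theta.
pose f t := norm2 ((bezier theta)^`(2)%classic t).
have fE t : f t = Num.sqrt (\sum_(i < 2) q i ^+ 2).[t].
  rewrite /f qE /norm2 horner_sum; congr Num.sqrt.
  by apply: eq_bigr => i _; rewrite mxE !hornerE.
have fc : continuous f.
  rewrite (_ : f = Num.sqrt \o horner (\sum_(i < 2) q i ^+ 2)); last first.
    by apply/funext => t; rewrite fE.
  move=> t; apply: continuous_comp; first exact: continuous_horner.
  exact: sqrt_continuous.
have [c c01 cmax] := @EVT_max R f 0 1 ler01 (continuous_subspaceT fc).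
have cI : `[0, 1]%classic c by [].
have ub : ubound [set f t | t in `[0, 1]] (f c).
  by move=> _ [t t01 <-]; exact: cmax.
have fcE : f c = bezier_d2_max theta.
  apply/eqP; rewrite eq_le; apply/andP; split.
    by apply: ub_le_sup; [exists (f c) | exists c].
  by apply: ge_sup => //; exists (f c), c.
by split; [exists c | move=> t /cmax; rewrite -fcE].
Qed.

Lemma locus_polyline_path (R : realType) (theta : 'I_4 -> 'rV[R]_2) (S : nat) :
  (0 < S)%N -> locus (polyline_path theta S) = polyline theta S.
Proof.
move=> S0; have S0' : 0 < S%:R :> R by rewrite ltr0n.
have pathE (k : nat) (u : R) : 0 <= u <= 1 ->
    polyline_path theta S ((k%:R + u) / S%:R) =
    (1 - u) *: polyline_vertex theta S k + u *: polyline_vertex theta S k.+1.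
  move=> /andP[u0 u1]; rewrite /polyline_path.
  have -> : S%:R * ((k%:R + u) / S%:R) = k%:R + u by rewrite mulrC divfK ?gt_eqF.
  have [->|un1] := eqVneq u 1.
    have -> : Num.truncn (k%:R + 1 : R) = k.+1 by rewrite natr1 natrK.
    by rewrite natr1 !subrr subr0 !scale0r !scale1r addr0 add0r.
  have -> : Num.truncn (k%:R + u : R) = k.
    apply: truncn_def; rewrite lerDl u0/= -natr1 ltrD2l.
    by rewrite lt_neqAle un1.
  by have -> : k%:R + u - k%:R = u by rewrite addrC addKr.
rewrite /locus /polyline /segment; apply/seteqP; split => x.
- move=> [t]; rewrite /= in_itv /= => /andP[t0 t1] <-.
  have tE : t = (S%:R * t) / S%:R by rewrite mulrC mulKf ?gt_eqF.
  have [->|tn1] := eqVneq t 1.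
    exists S.-1 => /=; first by rewrite prednK.
    exists 1; first by rewrite /= in_itv /= ler01 lexx.
    rewrite -pathE ?ler01 ?lexx//; congr polyline_path.
    by rewrite natr1 prednK// divff// gt_eqF.
  have /andP[k1 k2] := truncn_itv (mulr_ge0 (ltW S0') t0).
  exists (Num.truncn (S%:R * t)) => /=.
    by rewrite -(ltr_nat R) (le_lt_trans k1)// gtr_pMr// lt_neqAle tn1.
  exists (S%:R * t - (Num.truncn (S%:R * t))%:R) => //=.
  by rewrite in_itv /= subr_ge0 k1 lerBlDl natr1 ltW.
- move=> [k /= kS] [u]; rewrite /= in_itv /= => u01 <-.
  exists ((k%:R + u) / S%:R); last by rewrite pathE.
  have /andP[u0 u1] := u01.
  rewrite /= in_itv /= divr_ge0 ?addr_ge0 ?ler0n//= ler_pdivrMr// mul1r.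
  by rewrite (le_trans (lerD (lexx _) u1))// natr1 ler_nat.
Qed.

(* Main.v *)
Require Import Defs.
From mathcomp Require Import all_boot all_order all_algebra.
From mathcomp Require Import all_classical all_reals all_analysis.
From mathcomp Require Import ring lra.

Import Order.TTheory GRing.Theory Num.Theory.
Import numFieldNormedType.Exports.

Local Open Scope classical_set_scope.
Local Open Scope ring_scope.

(* For a cubic the linear interpolation error on an interval is an explicit
   multiple, of size at most 1/8 of the squared length, of the second derivative
   at a point of that interval.  Hence b and its polyline, traversed at the same
   speed, stay within eps of each other; this bounds the Hausdorff distance, and
   with it the difference of the distances to the two sets.

   If moreover eps < d(x, B), then |b t - p t| < |b t - x|, so b t - x and p t - x
   always make an angle psi t in ]-pi/2, pi/2[, given by an arctangent and hence
   continuous.  Adding or subtracting psi converts a continuous angle along one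
   curve into one along the other.  Since psi 0 = psi 1 for closed curves, the
   same numbers of turns are realised by both, so the winding numbers agree
   without any appeal to existence or uniqueness of lifts. *)

(** * Euclidean norm, distance to a set, Hausdorff distance *)

Section Euclidean.
Context {R : realType} {n : nat}.
Implicit Types (x y : 'rV[R]_n) (A B : set 'rV[R]_n).

Lemma norm2_ge0 x : 0 <= norm2 x.
Proof. exact: sqrtr_ge0. Qed.

Lemma sqr_norm2 x : norm2 x ^+ 2 = \sum_(i < n) x ord0 i ^+ 2.
Proof. by rewrite sqr_sqrtr// sumr_ge0// => i _; exact: sqr_ge0. Qed.

Lemma norm2Z (c : R) x : norm2 (c *: x) = `|c| * norm2 x.
Proof.
rewrite -sqrtr_sqr -sqrtrM ?sqr_ge0// mulr_sumr; congr Num.sqrt.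
by apply: eq_bigr => i _; rewrite mxE exprMn.
Qed.

Lemma norm2_distC x y : norm2 (x - y) = norm2 (y - x).
Proof. by rewrite -opprB -scaleN1r norm2Z normrN1 mul1r. Qed.

Lemma norm2_eq0 x : norm2 x = 0 -> x = 0.
Proof.
move=> x0; have /psumr_eq0P : \sum_(i < n) x ord0 i ^+ 2 = 0.
  by rewrite -sqr_norm2 x0 expr0n.
move=> /(_ (fun i _ => sqr_ge0 _)) xi0; apply/rowP => i; rewrite mxE.
by apply/eqP; rewrite -sqrf_eq0 xi0.
Qed.

(** With a = |x| and b = |y|, the sum of the squares (b x_i - a y_i)^2 equals 2ab (ab - <x, y>). It
    is nonnegative, and 2ab can be cancelled once zero vectors are set aside. *)
Lemma cauchy_schwarz x y :
  \sum_(i < n) x ord0 i * y ord0 i <= norm2 x * norm2 y.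
Proof.
have := norm2_ge0 x; rewrite le_eqVlt => /predU1P[/esym/norm2_eq0 ->|x0].
  by rewrite big1 ?mulr_ge0 ?norm2_ge0// => i _; rewrite mxE mul0r.
have := norm2_ge0 y; rewrite le_eqVlt => /predU1P[/esym/norm2_eq0 ->|y0].
  by rewrite big1 ?mulr_ge0 ?norm2_ge0// => i _; rewrite mxE mulr0.
set a := norm2 x in x0 *; set b := norm2 y in y0 *.
have : 0 <= \sum_(i < n) (b * x ord0 i - a * y ord0 i) ^+ 2.
  by apply: sumr_ge0 => i _; exact: sqr_ge0.
have -> : \sum_(i < n) (b * x ord0 i - a * y ord0 i) ^+ 2 =
    2 * (a * b) * (a * b - \sum_(i < n) x ord0 i * y ord0 i).
  rewrite [RHS](_ : _ = b ^+ 2 * a ^+ 2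
      - 2 * (a * b) * (\sum_(i < n) x ord0 i * y ord0 i) + a ^+ 2 * b ^+ 2);
    last by ring.
  rewrite [a ^+ 2 in X in X - _]sqr_norm2 [b ^+ 2 in X in _ + X]sqr_norm2.
  rewrite !mulr_sumr -sumrB -big_split/=.
  by apply: eq_bigr => i _; ring.
by rewrite pmulr_rge0 ?subr_ge0// !mulr_gt0.
Qed.

Lemma norm2_triangle x y : norm2 (x + y) <= norm2 x + norm2 y.
Proof.
rewrite -(@ler_pXn2r _ 2) ?nnegrE ?addr_ge0 ?norm2_ge0//.
rewrite sqrrD !sqr_norm2.
have -> : \sum_(i < n) (x + y) ord0 i ^+ 2 = \sum_(i < n) x ord0 i ^+ 2 +
   (\sum_(i < n) x ord0 i * y ord0 i) *+ 2 + \sum_(i < n) y ord0 i ^+ 2.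
  rewrite -mulr_natl mulr_sumr -!big_split/=.
  by apply: eq_bigr => i _; rewrite !mxE; ring.
by rewrite lerD2r lerD2l lerMn2r cauchy_schwarz orbT.
Qed.

Lemma dist_to_le x y A : A y -> dist_to x A <= norm2 (x - y).
Proof.
move=> Ay; apply: ge_inf; last by exists y.
by exists 0 => _ [z _ <-]; exact: norm2_ge0.
Qed.

Lemma dist_to_ge x A (c : R) : A !=set0 ->
  (forall y, A y -> c <= norm2 (x - y)) -> c <= dist_to x A.
Proof.
move=> [y Ay] cA; apply: lb_le_inf; first by exists (norm2 (x - y)), y.
by move=> _ [z Az <-]; exact: cA.
Qed.

(** Each a in A gives d(x, B) <= |x - a| + d(a, B) <= |x - a| + h; then take the infimum over a. *)
Lemma dist_to_triangle x A B (h : R) : A !=set0 ->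
  (forall a, A a -> dist_to a B <= h) -> B !=set0 ->
  dist_to x B <= dist_to x A + h.
Proof.
move=> A0 AB B0; rewrite -lerBlDr; apply: dist_to_ge => // a Aa.
rewrite lerBlDr (le_trans _ (lerD (lexx _) (AB a Aa)))//.
rewrite -lerBlDl; apply: dist_to_ge => // b Bb; rewrite lerBlDl.
rewrite (le_trans (dist_to_le _ _ _ Bb))//.
rewrite (le_trans _ (norm2_triangle (x - a) (a - b)))//.
by rewrite subrKA.
Qed.

Lemma hausdorff_dist_le A B (h : R) : A !=set0 -> B !=set0 ->
  (forall a, A a -> dist_to a B <= h) -> (forall b, B b -> dist_to b A <= h) ->
  hausdorff_dist A B <= h.
Proof.
move=> [a Aa] [b Bb] AB BA; rewrite /hausdorff_dist ge_max.
apply/andP; split; apply: ge_sup; first by exists (dist_to a B), a.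
- by move=> _ [z Az <-]; exact: AB.
- by exists (dist_to b A), b.
- by move=> _ [z Bz <-]; exact: BA.
Qed.

(** The bound [h] is absent from the conclusion: it makes the two suprema in [hausdorff_dist]
    genuine, since [sup] defaults to 0 on unbounded sets. *)
Lemma dist_to_sub_le_hausdorff A B (h : R) x : A !=set0 -> B !=set0 ->
  (forall a, A a -> dist_to a B <= h) -> (forall b, B b -> dist_to b A <= h) ->
  `|dist_to x A - dist_to x B| <= hausdorff_dist A B.
Proof.
move=> A0 B0 AB BA.
have AH a : A a -> dist_to a B <= hausdorff_dist A B.
  move=> Aa; rewrite le_max; apply/orP; left.
  apply: ub_le_sup; last by exists a.
  by exists h => _ [z Az <-]; exact: AB.
have BH b : B b -> dist_to b A <= hausdorff_dist A B.
  move=> Bb; rewrite le_max; apply/orP; right.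
  apply: ub_le_sup; last by exists b.
  by exists h => _ [z Bz <-]; exact: BA.
rewrite ler_distlC lerBlDr.
by rewrite !dist_to_triangle.
Qed.

End Euclidean.

(** * Stability of the winding number under small perturbations *)

Section Winding.
Context {R : realType}.
Implicit Types (gamma delta : R -> 'rV[R]_2) (u v x : 'rV[R]_2).

(** In complex notation, [dot u v] and [cross u v] are the real and imaginary parts of conj(u) v. *)
Let dot u v := u ord0 0 * v ord0 0 + u ord0 1 * v ord0 1.
Let cross u v := u ord0 0 * v ord0 1 - u ord0 1 * v ord0 0.

Lemma sum_ord2 (f : 'I_2 -> R) : \sum_(i < 2) f i = f 0 + f 1.
Proof.
by rewrite big_ord_recl big_ord1; congr (_ + f _); apply: val_inj.
Qed.

(** Expanding |u - v|^2 < |u|^2 gives 2 <u, v> > |v|^2 >= 0. *)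
Lemma dot_gt0_of_close u v : norm2 (u - v) < norm2 u -> 0 < dot u v.
Proof.
rewrite -(@ltr_pXn2r _ 2) ?nnegrE ?norm2_ge0// !sqr_norm2.
rewrite !sum_ord2 !mxE => h; rewrite /dot.
have := sqr_ge0 (v ord0 0); have := sqr_ge0 (v ord0 1).
by lra.
Qed.

Lemma dotC u v : dot u v = dot v u.
Proof. by rewrite /dot ![v _ _ * _]mulrC. Qed.

(** The quotient is the tangent of the angle from u to v; positivity of [dot u v] places that angle
    in ]-pi/2, pi/2[, where [atan] recovers it. *)
Lemma rotate_by_atan u v (phi : R) : 0 < dot u v ->
  u = norm2 u *: \row_(i < 2) (if i == ord0 then cos phi else sin phi) ->
  v = norm2 v *: \row_(i < 2) (if i == ord0
    then cos (phi + atan (cross u v / dot u v))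
    else sin (phi + atan (cross u v / dot u v))).
Proof.
move=> d0 uE; set psi := atan _.
have u_gt0 : 0 < norm2 u.
  rewrite lt_neqAle norm2_ge0 andbT eq_sym; apply/eqP => /norm2_eq0 u0.
  by move: d0; rewrite u0 /dot !mxE !mul0r addr0 ltxx.
have v_gt0 : 0 < norm2 v.
  rewrite lt_neqAle norm2_ge0 andbT eq_sym; apply/eqP => /norm2_eq0 v0.
  by move: d0; rewrite v0 /dot !mxE !mulr0 addr0 ltxx.
(* Lagrange's identity turns the tangent of [psi] into its cosine and sine, with common denominator
   |u| |v|. *)
have lagrange : dot u v ^+ 2 + cross u v ^+ 2 = (norm2 u * norm2 v) ^+ 2.
  by rewrite exprMn !sqr_norm2 /dot /cross !sum_ord2; ring.
have cosE : cos psi = dot u v / (norm2 u * norm2 v).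
  rewrite cos_atan.
  have -> : 1 + (cross u v / dot u v) ^+ 2 =
      ((norm2 u * norm2 v) / dot u v) ^+ 2.
    by rewrite [RHS]expr_div_n -lagrange; field; rewrite gt_eqF.
  by rewrite sqrtr_sqr ger0_norm ?invf_div// divr_ge0 ?mulr_ge0 ?ltW.
have sinE : sin psi = cross u v / (norm2 u * norm2 v).
  have cos0 : cos psi != 0 by rewrite cosE gt_eqF// divr_gt0// mulr_gt0.
  have : tan psi = cross u v / dot u v by exact: atanK.
  rewrite /tan => /(canRL (divfK cos0)) ->; rewrite cosE; field.
  by rewrite !gt_eqF.
have u0 : u ord0 0 = norm2 u * cos phi by rewrite {1}uE !mxE.
have u1 : u ord0 1 = norm2 u * sin phi by rewrite {1}uE !mxE.
have u2 : norm2 u ^+ 2 = u ord0 0 ^+ 2 + u ord0 1 ^+ 2.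
  by rewrite sqr_norm2 sum_ord2.
have cE : cos phi = u ord0 0 / norm2 u by rewrite u0 mulrC mulKf ?gt_eqF.
have sE : sin phi = u ord0 1 / norm2 u by rewrite u1 mulrC mulKf ?gt_eqF.
(* By the addition formulas the right-hand coordinate is v_i (u_0^2 + u_1^2) / |u|^2, that is
   v_i. *)
apply/rowP => i; rewrite !mxE cosD sinD cosE sinE cE sE.
rewrite /dot /cross.
have [->|i1] := eqVneq i ord0.
- transitivity (v ord0 0 * (u ord0 0 ^+ 2 + u ord0 1 ^+ 2) / norm2 u ^+ 2).
    by rewrite -u2 mulfK// sqrf_eq0 gt_eqF.
  by field; rewrite !gt_eqF.
- have -> : i = 1 by apply: val_inj; case: i i1 => -[|[]].
  transitivity (v ord0 1 * (u ord0 0 ^+ 2 + u ord0 1 ^+ 2) / norm2 u ^+ 2).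
    by rewrite -u2 mulfK// sqrf_eq0 gt_eqF.
  by field; rewrite !gt_eqF.
Qed.

Lemma angle_lift_shift gamma delta x (phi : R -> R) :
  (forall i, {within `[0, 1], continuous (fun t => gamma t ord0 i)}) ->
  (forall i, {within `[0, 1], continuous (fun t => delta t ord0 i)}) ->
  (forall t, t \in `[0, 1] -> 0 < dot (gamma t - x) (delta t - x)) ->
  angle_lift gamma x phi ->
  angle_lift delta x (fun t => phi t +
    atan (cross (gamma t - x) (delta t - x) / dot (gamma t - x) (delta t - x))).
Proof.
move=> gc dc gd [phic phiE]; split; last first.
  by move=> t t01; apply: rotate_by_atan; [exact: gd | exact: phiE].
(* Restricting to points of [0, 1] gives access to the positivity of [dot], so the quotient is
   continuous there. *)
rewrite continuous_subspace_in => t t01.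
have gcx i : {for t, continuous
    ((fun s => (gamma s - x) ord0 i) : subspace (`[0, 1] : set R) -> R)}.
  rewrite (_ : (fun _ => _) = fun t => gamma t ord0 i - x ord0 i); last first.
    by apply/funext => s; rewrite !mxE.
  by apply: cvgB; [exact: gc | exact: cvg_cst].
have dcx i : {for t, continuous
    ((fun s => (delta s - x) ord0 i) : subspace (`[0, 1] : set R) -> R)}.
  rewrite (_ : (fun _ => _) = fun t => delta t ord0 i - x ord0 i); last first.
    by apply/funext => s; rewrite !mxE.
  by apply: cvgB; [exact: dc | exact: cvg_cst].
apply: cvgD; first exact: phic.
apply: continuous_comp; last exact: continuous_atan.
apply: cvgM.
  by apply: cvgB; apply: cvgM; [exact: gcx|exact: dcx|exact: gcx|exact: dcx].
apply: cvgV; first by rewrite gt_eqF// gd//; apply: set_mem t01.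
by apply: cvgD; apply: cvgM; [exact: gcx|exact: dcx|exact: gcx|exact: dcx].
Qed.

Lemma winding_number_close gamma delta x :
  (forall i, {within `[0, 1], continuous (fun t => gamma t ord0 i)}) ->
  (forall i, {within `[0, 1], continuous (fun t => delta t ord0 i)}) ->
  gamma 0 = gamma 1 -> delta 0 = delta 1 ->
  (forall t, t \in `[0, 1] ->
     norm2 (gamma t - delta t) < norm2 (gamma t - x)) ->
  winding_number gamma x = winding_number delta x.
Proof.
move=> gc dc g01 d01 gd.
have dot_gt0 t : t \in `[0, 1] -> 0 < dot (gamma t - x) (delta t - x).
  move=> /gd h; apply: dot_gt0_of_close.
  by rewrite opprB addrA subrK.
(* Equal sets of turn counts give equal values of [xget]. Both curves are closed, so the angle
   correction agrees at 0 and 1 and cancels from the increment; the converse inclusion exchanges the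
   curves. *)
rewrite /winding_number; congr xget; apply/seteqP; split => m [phi [lift phim]].
- eexists; split; first exact: (angle_lift_shift _ _ _ _ gc dc dot_gt0 lift).
  by rewrite /= g01 d01 opprD addrACA subrr addr0.
- eexists; split; first apply: (angle_lift_shift _ _ _ _ dc gc _ lift).
    by move=> t t01; rewrite dotC dot_gt0.
  by rewrite /= g01 d01 opprD addrACA subrr addr0.
Qed.

End Winding.

(** * Cubic curves: interpolation error, continuity, labels *)

Section Bezier.
Context {R : realType}.
Implicit Types (theta : 'I_4 -> 'rV[R]_2) (S : nat).

Lemma sum_ord4 (V : nmodType) (f : 'I_4 -> V) :
  \sum_(i < 4) f i = f 0 + f 1 + f 2%:R + f 3%:R.
Proof.
rewrite !big_ord_recl big_ord0 addr0 !addrA.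
by do !congr (_ + _); congr f; apply: val_inj.
Qed.

Lemma derive1_row_horner (n : nat) (q : 'I_n -> {poly R}) :
  (fun t => \row_i (q i).[t] : 'rV[R]_n)^`()%classic =
  fun t => \row_i ((q i)^`()%R).[t].
Proof.
have qE i j : (fun t => (\row_i (q i).[t] : 'rV[R]_n) i j) = horner (q j).
  by apply/funext => u; rewrite mxE.
apply/funext => t; rewrite derive1E derive_mx; last first.
  by apply/derivable_mxP => i j; rewrite qE; exact: derivable_horner.
by apply/rowP => i; rewrite !mxE qE derivE derive1E.
Qed.

(** Expansion in the monomial basis, so that differentiation becomes formal. *)
Definition bezier_poly theta (i : 'I_2) : {poly R} :=
  (theta 0 ord0 i)%:P + (3 * (theta 1 ord0 i - theta 0 ord0 i)) *: 'X +
  (3 * (theta 2%:R ord0 i - 2 * theta 1 ord0 i + theta 0 ord0 i)) *: 'X^2 +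
  (theta 3%:R ord0 i - 3 * theta 2%:R ord0 i + 3 * theta 1 ord0 i
     - theta 0 ord0 i) *: 'X^3.

Lemma bezierE theta t i : bezier theta t ord0 i = (bezier_poly theta i).[t].
Proof.
rewrite /bezier_poly !hornerE summxE sum_ord4 !mxE /=.
rewrite (_ : 'C(3, 0) = 1)// (_ : 'C(3, 1) = 3)// (_ : 'C(3, 2) = 3)//.
rewrite (_ : 'C(3, 3) = 1)//.
rewrite !subSS !subn0; ring.
Qed.

(** The second derivative is the degree-1 Bézier curve whose control points are 6 times the second
    differences of those of [theta]. *)
Lemma bezier_d2 theta t i : (bezier theta)^`(2)%classic t ord0 i =
  6 * ((1 - t) * (theta 2%:R ord0 i - 2 * theta 1 ord0 i + theta 0 ord0 i) +
       t * (theta 3%:R ord0 i - 2 * theta 2%:R ord0 i + theta 1 ord0 i)).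
Proof.
have -> : bezier theta = fun t => \row_i (bezier_poly theta i).[t].
  by apply/funext => s; apply/rowP => j; rewrite bezierE mxE.
rewrite /derive1n /= !derive1_row_horner mxE /bezier_poly.
rewrite !(derivD, derivZ, derivC, derivX, derivXn, derivMn).
rewrite !(hornerD, hornerZ, hornerMn, hornerX, hornerXn, hornerC).
rewrite -[2.-2%N]/0%N -[2.-1%N]/1%N.
ring.
Qed.

(* For a cubic [f], the error of linear interpolation on [a, a + h] is exactly
   - u (1 - u) h^2 / 2 * f'' (a + h (1 + u) / 3). *)
Lemma bezier_interpolation_error theta (a h u : R) :
  bezier theta (a + h * u) -
    ((1 - u) *: bezier theta a + u *: bezier theta (a + h)) =
  - (u * (1 - u) / 2 * h ^+ 2) *:
    (bezier theta)^`(2)%classic (a + h * (1 + u) / 3).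
Proof.
apply/rowP => i; rewrite !mxE bezier_d2 !bezierE /bezier_poly.
rewrite !(hornerD, hornerZ, hornerX, hornerXn, hornerC).
by field.
Qed.

Lemma bezier_d2_max_ge0 theta : 0 <= bezier_d2_max theta.
Proof.
by have [[t _ <-] _] := bezier_d2_max_attained theta; exact: norm2_ge0.
Qed.

Lemma flattening_error_ge0 theta S : 0 <= flattening_error theta S.
Proof. by rewrite divr_ge0 ?bezier_d2_max_ge0// mulr_ge0// exprn_ge0. Qed.

Lemma bezier_polyline_path_close theta S t : (0 < S)%N -> t \in `[0, 1] ->
  norm2 (bezier theta t - polyline_path theta S t) <= flattening_error theta S.
Proof.
move=> S0; rewrite in_itv/= => /andP[t0 t1].
have S_gt0 : 0 < S%:R :> R by rewrite ltr0n.
have /andP[k1 k2] := truncn_itv (mulr_ge0 (ltW S_gt0) t0).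
rewrite /polyline_path; set k := Num.truncn _ in k1 k2 *.
set u := S%:R * t - k%:R.
have u0 : 0 <= u by rewrite subr_ge0.
have u1 : u <= 1 by rewrite lerBlDl natr1 ltW.
have -> : polyline_vertex theta S k.+1 = bezier theta (k%:R / S%:R + S%:R^-1).
  by rewrite /polyline_vertex -natr1 mulrDl mul1r.
have -> : bezier theta t = bezier theta (k%:R / S%:R + S%:R^-1 * u).
  by congr bezier; rewrite /u; field; rewrite gt_eqF.
rewrite bezier_interpolation_error.
have uu : 0 <= u * (1 - u) by rewrite mulr_ge0// subr_ge0.
rewrite norm2Z normrN ger0_norm; last first.
  by rewrite mulr_ge0 ?sqr_ge0// divr_ge0.
(* At a vertex the error is zero. This case absorbs t = 1, where k = S and the evaluation point of
   b'' would lie beyond 1. *)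
have [->|un0] := eqVneq u 0.
  by rewrite !mul0r flattening_error_ge0.
have u_gt0 : 0 < u by rewrite lt_neqAle eq_sym un0.
have kS : (k < S)%N.
  rewrite -(ltr_nat R); apply: (@lt_le_trans _ _ (S%:R * t)).
    by rewrite -subr_gt0.
  by rewrite ger_pMr.
rewrite (_ : k%:R / S%:R + _ = (k%:R + (1 + u) / 3) / S%:R); last first.
  by field; rewrite gt_eqF.
(* Since u <= 1, the offset (1 + u) / 3 is below 1, so [xi] stays in the k-th subinterval. *)
set xi := _ / S%:R.
have xi01 : xi \in `[0, 1].
  have : k%:R + 1 <= S%:R :> R by rewrite natr1 ler_nat.
  rewrite in_itv/= divr_ge0 ?ler0n ?addr_ge0//= ?ler_pdivrMr// ?mul1r; lra.
have := (bezier_d2_max_attained theta).2 xi xi01.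
set N := norm2 _ => NM.
have N0 : 0 <= N by exact: norm2_ge0.
have hh : 0 <= S%:R^-1 ^+ 2 :> R by rewrite exprn_ge0// invr_ge0 ltW.
rewrite [leRHS](_ : _ = 8^-1 * S%:R^-1 ^+ 2 * bezier_d2_max theta); last first.
  by rewrite /flattening_error; field; rewrite gt_eqF.
apply: ler_pM => //; first by rewrite mulr_ge0// divr_ge0.
(* The constant 1/8: u (1 - u) = 1/4 - (u - 1/2)^2 is at most 1/4, and is halved. *)
by rewrite ler_wpM2r//; have := sqr_ge0 (u - 2^-1); lra.
Qed.

Lemma bezier_continuous theta i :
  continuous (fun t => bezier theta t ord0 i).
Proof.
rewrite (_ : (fun t => _) = horner (bezier_poly theta i)).
  exact: continuous_horner.
by apply/funext => t; rewrite bezierE.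
Qed.

(* Unlike its definition by [truncn], this form is visibly continuous. *)
Lemma polyline_path_ramps theta S t : (0 < S)%N -> t \in `[0, 1] ->
  polyline_path theta S t = polyline_vertex theta S 0 +
    \sum_(0 <= k < S) Num.max 0 (Num.min 1 (S%:R * t - k%:R)) *:
      (polyline_vertex theta S k.+1 - polyline_vertex theta S k).
Proof.
move=> S0; rewrite in_itv/= => /andP[t0 t1].
have S_gt0 : 0 < S%:R :> R by rewrite ltr0n.
have /andP[k1 k2] := truncn_itv (mulr_ge0 (ltW S_gt0) t0).
rewrite /polyline_path; set k := Num.truncn _ in k1 k2 *.
have kS : (k <= S)%N.
  by rewrite -(ler_nat R) (le_trans k1)// ger_pMr.
rewrite (big_cat_nat (leq0n k) kS)/=.
(* Ramps of index below k are saturated at 1, and their sum telescopes. *)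
rewrite (_ : \sum_(0 <= i < k) _ =
    polyline_vertex theta S k - polyline_vertex theta S 0); last first.
  rewrite -(telescope_sumr _ (leq0n k)); apply: eq_big_nat => i /andP[_ ik].
  have ik' : i%:R + 1 <= k%:R :> R by rewrite natr1 ler_nat.
  by rewrite min_l ?max_r ?scale1r//; lra.
rewrite addrA subrKC.
(* If k = S then S t = S, so vertex S + 1 has weight 0. Otherwise ramp k has value u and all later
   ramps are still 0. *)
move: kS; rewrite leq_eqVlt => /predU1P[kS|kS].
  rewrite -kS big_geq// addr0.
  have -> : k%:R * t - k%:R = 0.
    apply/eqP; rewrite eq_le subr_ge0 [X in X%:R * t]kS k1 andbT.
    by rewrite subr_le0 kS ger_pMr.
  by rewrite subr0 scale1r scale0r addr0.
rewrite big_ltn// big_nat_cond big1 ?addr0; last first.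
  move=> i /andP[/andP[ki _] _].
  have ki' : k%:R + 1 <= i%:R :> R by rewrite natr1 ler_nat.
  have h : S%:R * t - i%:R <= 0 by move: k2; rewrite -natr1; lra.
  by rewrite max_l ?scale0r// ge_min h orbT.
move: k2; rewrite -natr1 => k2.
rewrite min_r; last by lra.
rewrite max_r; last by lra.
by rewrite scalerBr scalerBl scale1r addrA addrAC.
Qed.

Lemma polyline_path_continuous theta S i : (0 < S)%N ->
  {within `[0, 1], continuous (fun t => polyline_path theta S t ord0 i)}.
Proof.
move=> S0.
pose f t := polyline_vertex theta S 0 ord0 i +
  \sum_(0 <= k < S) Num.max 0 (Num.min 1 (S%:R * t - k%:R)) *
    (polyline_vertex theta S k.+1 - polyline_vertex theta S k) ord0 i.
(* The sum of ramps [f] is continuous on the whole line and agrees with the path on [0, 1]. *)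
apply: (@subspace_eq_continuous _ _ _ f
  (fun t => polyline_path theta S t ord0 i)).
  move=> t /set_mem t01; rewrite /= polyline_path_ramps// /f [RHS]mxE.
  by congr (_ + _); rewrite summxE; apply: eq_bigr => k _; rewrite [RHS]mxE.
have ramp_continuous (k : nat) :
    continuous (fun s : R => Num.max 0 (Num.min 1 (S%:R * s - k%:R)) : R).
  move=> s; apply: (@continuous_max R R (cst 0)
    (fun s => Num.min 1 (S%:R * s - k%:R))); first exact: cvg_cst.
  apply: (@continuous_min R R (cst 1) (fun s => S%:R * s - k%:R)).
    exact: cvg_cst.
  apply: cvgB; last exact: cvg_cst.
  by apply: cvgM; [exact: cvg_cst|exact: cvg_id].
apply: (@continuous_subspaceT _ _ _ f) => t.
apply: cvgD; first exact: cvg_cst.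
apply: cvg_big => [|k _]; first exact: add_continuous.
by apply: cvgM; [exact: ramp_continuous|exact: cvg_cst].
Qed.

Lemma polyline_path0 theta S : polyline_path theta S 0 = bezier theta 0.
Proof.
rewrite /polyline_path mulr0 truncn0 subrr subr0 scale1r scale0r addr0.
by rewrite /polyline_vertex mul0r.
Qed.

Lemma polyline_path1 theta S : (0 < S)%N ->
  polyline_path theta S 1 = bezier theta 1.
Proof.
move=> S0; rewrite /polyline_path mulr1 natrK subrr subr0 scale1r scale0r addr0.
by rewrite /polyline_vertex divff// pnatr_eq0 -lt0n.
Qed.

Lemma locus_neq0 (gamma : R -> 'rV[R]_2) : locus gamma !=set0.
Proof. by exists (gamma 0), 0 => //=; rewrite in_itv/= lexx ler01. Qed.

Lemma dist_to_locus_gt (gamma : R -> 'rV[R]_2) x (e : R) t :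
  e < dist_to x (locus gamma) -> t \in `[0, 1] -> e < norm2 (gamma t - x).
Proof.
by move=> ed t01; rewrite (lt_le_trans ed)// norm2_distC dist_to_le//; exists t.
Qed.

(** The strict inequality keeps x off both loci, so both labels are read from winding numbers rather
    than from [oncurve]. *)
Lemma inside_close oncurve (gamma delta : R -> 'rV[R]_2) x (e : R) :
  (forall i, {within `[0, 1], continuous (fun t => gamma t ord0 i)}) ->
  (forall i, {within `[0, 1], continuous (fun t => delta t ord0 i)}) ->
  gamma 0 = gamma 1 -> delta 0 = delta 1 ->
  (forall t, t \in `[0, 1] -> norm2 (gamma t - delta t) <= e) ->
  e < dist_to x (locus gamma) ->
  inside oncurve gamma x = inside oncurve delta x.
Proof.
move=> gc dc g01 d01 gde xe.
have close t : t \in `[0, 1] -> norm2 (gamma t - delta t) < norm2 (gamma t - x).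
  move=> t01; rewrite (le_lt_trans (gde t t01))//.
  by rewrite (dist_to_locus_gt _ _ _ _ xe).
have xg : x \notin locus gamma.
  apply/negP => /set_mem[t t01 tx].
  have := close t t01; rewrite -tx subrr -(scale0r 0) norm2Z normr0 mul0r.
  by rewrite ltNge norm2_ge0.
have xd : x \notin locus delta.
  by apply/negP => /set_mem[t t01 tx]; have := close t t01; rewrite -tx ltxx.
rewrite /inside (negbTE xg) (negbTE xd).
by rewrite (winding_number_close _ _ _ gc dc g01 d01 close).
Qed.

Lemma lipschitz_le (K : R -> R) (L : R) : L.-lipschitz K ->
  forall y z, `|K y - K z| <= L * `|y - z|.
Proof. by move=> KL y z; exact: (KL (y, z)). Qed.

Lemma lipschitz_cst_ge0 (K : R -> R) (L : R) : L.-lipschitz K -> 0 <= L.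
Proof.
move=> /lipschitz_le/(_ 1 0); rewrite subr0 normr1 mulr1.
exact: le_trans.
Qed.

End Bezier.

(** * Assembly of the distance, coverage and label bounds *)

Theorem mainTheorem1 (R : realType) (theta : 'I_4 -> 'rV[R]_2) (S : nat)
    (S_ge1 : (1 <= S)%N) :
  let b := bezier theta in
  let p := polyline_path theta S in
  let B := locus b in
  let P := polyline theta S in
  let eps := flattening_error theta S in
  [/\ hausdorff_dist B P <= eps,
      forall x : 'rV[R]_2,
        `|dist_to x B - dist_to x P| <= hausdorff_dist B P /\
        hausdorff_dist B P <= eps,
      forall (K : R -> R) (L r : R),
        (forall y, 0 <= K y <= 1) -> L.-lipschitz K -> 0 <= r ->
        forall x : 'rV[R]_2,
          `|stroke_coverage K r B x - stroke_coverage K r P x| <= L * eps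
    &
      forall (K : R -> R) (L : R)
             (oncurve : (R -> 'rV[R]_2) -> 'rV[R]_2 -> bool),
        b 0 = b 1 ->
        (forall y, 0 <= K y <= 1) -> L.-lipschitz K ->
        forall x : 'rV[R]_2,
          let lab := inside oncurve b x in
          let lab' := inside oncurve p x in
          [/\ lab = lab' ->
                `|fill_coverage K lab B x - fill_coverage K lab' P x|
                  <= L * eps,
              eps < dist_to x B -> lab = lab'
            & lab <> lab' ->
                `|fill_coverage K lab B x - fill_coverage K lab' P x|
                  <= L * eps + `|lab%:R - lab'%:R| /\
                `|lab%:R - lab'%:R| <= 1 :> R]].
Proof.
move=> b p B P eps.
have close t : t \in `[0, 1] -> norm2 (b t - p t) <= eps.
  exact: bezier_polyline_path_close.
have PE : P = locus p by rewrite /P -locus_polyline_path.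
(* In both directions the witness is the point of the other curve at the same parameter. *)
have BP x : B x -> dist_to x P <= eps.
  move=> [t t01 <-]; rewrite (le_trans (dist_to_le _ (p t) _ _) (close t t01))//.
  by rewrite PE; exists t.
have PB x : P x -> dist_to x B <= eps.
  rewrite PE => -[t t01 <-].
  rewrite (le_trans (dist_to_le _ (b t) _ _))//; first by exists t.
  by rewrite norm2_distC close.
have B0 : B !=set0 by exact: locus_neq0.
have P0 : P !=set0 by rewrite PE; exact: locus_neq0.
have H : hausdorff_dist B P <= eps by exact: hausdorff_dist_le.
have dH x : `|dist_to x B - dist_to x P| <= hausdorff_dist B P.
  exact: (dist_to_sub_le_hausdorff _ _ eps).
have deps x : `|dist_to x B - dist_to x P| <= eps by exact: le_trans (dH x) H.
split=> //.
- move=> K L r _ KL _ x.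
  rewrite (le_trans (lipschitz_le _ _ KL _ _))// ler_wpM2l//.
    exact: lipschitz_cst_ge0 KL.
  by rewrite opprD addrACA subrr add0r -opprD normrN deps.
- move=> K L oncurve b01 K01 KL x lab lab'; have L0 := lipschitz_cst_ge0 _ _ KL.
  split.
  + move=> <-; rewrite (le_trans (lipschitz_le _ _ KL _ _))// ler_wpM2l//.
    (* The common sign factors out of the difference and has absolute value 1. *)
    rewrite -mulrBr normrM (_ : `|_| = 1) ?mul1r ?deps//.
    by rewrite /label_sign; case: lab; rewrite ?normrN normr1.
  + apply: inside_close close => //.
    * by move=> i; apply: continuous_subspaceT; exact: bezier_continuous.
    * by move=> i; exact: polyline_path_continuous.
    * by rewrite /p polyline_path0 polyline_path1.
  + move=> lab_neq.
    (* For different labels the indicator term is 1, which already dominates the difference of two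
       values of [K] in [0, 1]; adding L eps >= 0 preserves the bound. *)
    have -> : `|lab%:R - lab'%:R| = 1 :> R.
      by case: lab lab' lab_neq => -[]//= _; rewrite ?subr0 ?sub0r ?normrN normr1.
    split=> //; apply: (@le_trans _ _ 1); last first.
      by rewrite lerDr mulr_ge0 ?flattening_error_ge0.
    have /andP[k0 k1] := K01 (label_sign R lab * dist_to x B).
    have /andP[k0' k1'] := K01 (label_sign R lab' * dist_to x P).
    by rewrite ler_norml /fill_coverage; apply/andP; split; lra.
Qed.
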